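(* Let $k$ be a quadratically closed field. Then every element of $\mathrm{SL}_2(k)\setminus \{-I\}$ can be written as a commutator of a unipotent element and a semisimple element.
   Context: A field is quadratically closed if it admits no quadratic extension. The commutator is $[x,y]=xyx^{-1}y^{-1}$. Here ''semisimple'' and ''unipotent'' are in the usual sense: semisimple means diagonalizable over an algebraic closure (central elements, in particular the identity, are allowed), and unipotent means all eigenvalues equal to $1$. *)

(* Defs.v *)
From mathcomp Require Import all_boot all_order all_algebra all_field.

Set Implicit Arguments.
Unset Strict Implicit.
Unset Printing Implicit Defensive.

Import GRing.Theory.
Local Open Scope ring_scope.

Definition quadratically_closed (k : fieldType) : Prop :=
  forall L : fieldExtType k, \dim {: L} <> 2%N.

(* MathComp has no algebraic closure operation for arbitrary fields, so one is
   given by its defining property.  It always exists mathematically and is unique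
   up to k-isomorphism, so the definitions below quantify over all of them:
   the conditions do not depend on which closure is taken. *)
Definition is_algebraic_closure (k : fieldType) (K : closedFieldType)
    (iota : {rmorphism k -> K}) : Prop :=
  forall x : K, algebraicOver iota x.

Definition semisimple_mx (k : fieldType) (n : nat) (A : 'M[k]_n) : Prop :=
  forall (K : closedFieldType) (iota : {rmorphism k -> K}),
    is_algebraic_closure iota -> diagonalizable (map_mx iota A).

Definition unipotent_mx (k : fieldType) (n : nat) (A : 'M[k]_n) : Prop :=
  forall (K : closedFieldType) (iota : {rmorphism k -> K}),
    is_algebraic_closure iota ->
    forall a : K, eigenvalue (map_mx iota A) a -> a = 1.

Definition SL (k : fieldType) (n : nat) : {pred 'M[k]_n} :=
  [pred A : 'M[k]_n | \det A == 1].

Arguments SL k n : clear implicits.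

(* x y x^-1 y^-1, not the convention x^-1 y^-1 x y of fingroup's [~ x, y]. *)
Definition commutator_mx (k : fieldType) (n : nat) (x y : 'M[k]_n) : 'M[k]_n :=
  x *m y *m invmx x *m invmx y.

(* Main.v *)
(** Put [u = [[1,1],[0,1]]]. If [s] has first column [(a,c)] and determinant
    [1], then the commutator of [u] and [s] has trace [2 + c^2], and square
    roots in [k] let us reach any trace. If [c <> 0], the last entry of [s] is
    free and can be chosen so that [s] has distinct eigenvalues [l], [1/l];
    trace [2] is reached with [s = diag(l, 1/l)]. Two non-scalar 2x2 matrices with
    the same trace and determinant are similar to the same companion matrix,
    so conjugating [u] and [s] yields every non-scalar element of [SL_2(k)].
    The scalar ones are [1] and the excluded [-1]. *)
From Stdlib Require Import Classical_Prop.
Require Import Defs.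
From mathcomp Require Import all_boot all_order all_algebra all_field.
From mathcomp Require Import ring.
Local Open Scope ring_scope.
Import GRing.Theory.

Definition mx2 {R : Type} (a b c d : R) : 'M[R]_2 :=
  \matrix_(i, j) if i == ord0 then if j == ord0 then a else b
                 else if j == ord0 then c else d.

Lemma mx2_eta {R : Type} (A : 'M[R]_2) :
  A = mx2 (A ord0 ord0) (A ord0 ord_max) (A ord_max ord0) (A ord_max ord_max).
Proof.
apply/matrixP=> -[[|[|//]] hi] [[|[|//]] hj]; rewrite mxE /=;
  by congr (A _ _); apply/val_inj.
Qed.

Lemma mulmx2 {R : pzRingType} (a b c d a' b' c' d' : R) :
  mx2 a b c d *m mx2 a' b' c' d' =
  mx2 (a * a' + b * c') (a * b' + b * d') (c * a' + d * c') (c * b' + d * d').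
Proof.
apply/matrixP=> i j; rewrite !mxE !big_ord_recl big_ord0 addr0 !mxE /=.
by case: (i == ord0); case: (j == ord0).
Qed.

Lemma scalar_mx2 {R : pzRingType} (a : R) : a%:M = mx2 a 0 0 a.
Proof. by rewrite [LHS]mx2_eta !mxE. Qed.

Lemma det_mx2 {R : comPzRingType} (a b c d : R) :
  \det (mx2 a b c d) = a * d - b * c.
Proof.
rewrite (expand_det_row _ ord0) !big_ord_recl big_ord0 addr0 /cofactor.
by rewrite !det_mx11 !mxE /= /bump /= expr0 expr1 mul1r mulN1r mulrN.
Qed.

Lemma mxtrace_mx2 {R : pzRingType} (a b c d : R) : \tr (mx2 a b c d) = a + d.
Proof. by rewrite /mxtrace !big_ord_recl big_ord0 addr0 !mxE. Qed.

Definition mx2E := (@mulmx2, @scalar_mx2, @det_mx2, @mxtrace_mx2).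

(** The rows of [P] are [v] and [v *m A] for a cyclic [v]; the second row of the equation is then
    Cayley-Hamilton applied to [v]. *)
Lemma companion_mx2 {k : fieldType} (A : 'M[k]_2) : ~~ is_scalar_mx A ->
  exists2 P, P \in unitmx & P *m A = mx2 0 1 (- \det A) (\tr A) *m P.
Proof.
rewrite (mx2_eta A); move: (A _ _) (A _ _) (A _ _) (A _ _) => d c b a nsA.
(* [(x, y)] is a cyclic row vector for [A]. *)
suff [x [y hxy]] : exists x y, x * (x * b + y * d) - y * (x * a + y * c) != 0.
  exists (mx2 x y (x * a + y * c) (x * b + y * d)).
    by rewrite unitmxE mx2E unitfE.
  by rewrite !mx2E; congr mx2; ring.
(* A nonzero off-diagonal entry makes a basis vector cyclic; for a diagonal matrix with [a != d],
   [(1, 1)] is cyclic. *)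
have [b0|nb0] := eqVneq b 0; last first.
  by exists 1, 0; rewrite !mul0r !mul1r subr0 addr0.
have [c0|nc0] := eqVneq c 0; last first.
  by exists 0, 1; rewrite !mul0r !mul1r !add0r oppr_eq0.
exists 1, 1; rewrite b0 c0 !mul1r add0r addr0 subr_eq0.
apply: contra nsA => /eqP->; rewrite b0 c0 -scalar_mx2.
exact: scalar_mx_is_scalar.
Qed.

Lemma similar_mx2 {k : fieldType} (A B : 'M[k]_2) :
    ~~ is_scalar_mx A -> ~~ is_scalar_mx B ->
    \det A = \det B -> \tr A = \tr B ->
  exists2 P, P \in unitmx & P *m A = B *m P.
Proof.
move=> /companion_mx2[P uP PA] /companion_mx2[Q uQ QB] eqd eqt.
exists (invmx Q *m P); first by rewrite unitmx_mul unitmx_inv uQ.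
rewrite -mulmxA PA eqd eqt -[in LHS](mulmxK uQ (mx2 _ _ _ _)) -QB.
by rewrite !mulmxA mulVmx // mul1mx.
Qed.

(** Without a root the quadratic would be irreducible, and adjoining one would give an extension of
    dimension 2. *)
Lemma quadratically_closed_root {k : fieldType} (b c : k) :
  quadratically_closed k -> exists x, x ^+ 2 + b * x + c = 0.
Proof.
move=> hk; pose p : {poly k} := 'X^2 + (b *: 'X + c%:P).
have szp : size p = 3%N.
  rewrite size_polyDl size_polyXn //.
  rewrite (leq_ltn_trans (size_polyD _ _)) // ltnS geq_max size_polyC.
  by rewrite (leq_trans (size_scale_leq _ _)) ?size_polyX //=; case: (c != 0).
(* [quadratically_closed] is a negative statement, so the root itself can
   only be obtained by classical reasoning. *)
apply: NNPP => noroot; have p_irr : irreducible_poly p.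
  apply: cubic_irreducible => [|x]; first by rewrite szp.
  apply/negP => /rootP; rewrite !hornerE => px0; apply: noroot; by exists x.
have [L dimL _] := irredp_FAdjoin p_irr.
by apply: (hk L); rewrite dimL szp.
Qed.

(** Take a root of [x^2 + x + 1] in characteristic 2 and a square root of [-1] otherwise. The
    condition says that [l] and [l^-1] differ. *)
Lemma quadratically_closed_sqr_neq1 {k : fieldType} :
  quadratically_closed k -> exists2 l : k, l != 0 & l ^+ 2 != 1.
Proof.
move=> hk; have [two0|two_neq0] := eqVneq (2 : k) 0.
  have [x xP] := quadratically_closed_root 1 1 hk.
  have x_neq0 : x != 0.
    by apply: contra_eq_neq xP => ->; rewrite expr0n mulr0 !add0r oner_eq0.
  exists x => //; apply: contra_neq x_neq0 => x2.
  by rewrite -xP x2 -[x in LHS]addr0 -two0; ring.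
have [x xP] := quadratically_closed_root 0 1 hk; exists x.
  by apply: contra_eq_neq xP => ->; rewrite expr0n mul0r !add0r oner_eq0.
apply: contra_eq_neq xP => ->; rewrite mul0r addr0.
exact: two_neq0.
Qed.

(** On an eigenvector for [a], applying [A - 1] twice multiplies by [(a - 1)^2], which must
    vanish. *)
Lemma unipotent_mx_sqr0 {k : fieldType} {n : nat} (A : 'M[k]_n) :
  (A - 1%:M) *m (A - 1%:M) = 0 -> unipotent_mx A.
Proof.
move=> A1 K iota _ a /eigenvalueP[v vA v_neq0].
have vA1 : v *m map_mx iota (A - 1%:M) = (a - 1) *: v.
  by rewrite map_mxB map_mx1 mulmxBr vA mulmx1 scalerBl scale1r.
have : v *m map_mx iota ((A - 1%:M) *m (A - 1%:M)) = (a - 1) ^+ 2 *: v.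
  by rewrite map_mxM mulmxA vA1 -scalemxAl vA1 scalerA.
rewrite A1 map_mx0 mulmx0 => /esym/eqP.
by rewrite scaler_eq0 (negPf v_neq0) orbF sqrf_eq0 subr_eq0 => /eqP.
Qed.

Lemma semisimple_mx_similar {k : fieldType} {n : nat} (A D P : 'M[k]_n) :
  P \in unitmx -> is_diag_mx D -> P *m A = D *m P -> semisimple_mx A.
Proof.
move=> uP dD PA K iota _; exists (map_mx iota P); first by rewrite map_unitmx.
apply/diag_mxP.
have /is_diag_mxP dD' := dD.
exists (map_mx iota (\row_i D i i)).
rewrite conjumx ?map_unitmx // -map_mxM PA map_mxM mulmxK ?map_unitmx //.
rewrite -map_diag_mx; congr map_mx; apply/matrixP => i j; rewrite !mxE.
by have [->|ij] := eqVneq i j; rewrite ?mulr1n // dD'.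
Qed.

Lemma commutator_mx_eq {k : fieldType} {n : nat} (g u s : 'M[k]_n) :
  u \in unitmx -> s \in unitmx -> g *m s *m u = u *m s -> g = commutator_mx u s.
Proof. by move=> uu us gsu; rewrite /commutator_mx -gsu !mulmxK. Qed.

Lemma det_conj {k : fieldType} {n : nat} (P A : 'M[k]_n) :
  P \in unitmx -> \det (invmx P *m A *m P) = \det A.
Proof.
move=> uP; rewrite !det_mulmx det_inv mulrC mulrA divff ?mul1r //.
by rewrite -unitfE -unitmxE.
Qed.

(** Conjugation by [P] preserves every condition on [u] and [s], so it is enough to treat a
    convenient conjugate [g'] of [g]. The commutator equation is stated without inverses, to be
    checked entrywise. *)
Lemma commutator_of_similar {k : fieldType} {n : nat} (g g' u s D P Q : 'M[k]_n) :
    P \in unitmx -> P *m g = g' *m P ->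
    \det u = 1 -> (u - 1%:M) *m (u - 1%:M) = 0 ->
    \det s = 1 -> Q \in unitmx -> is_diag_mx D -> Q *m s = D *m Q ->
    g' *m s *m u = u *m s ->
  exists u s : 'M[k]_n,
    [/\ u \in SL k n, s \in SL k n, unipotent_mx u, semisimple_mx s
      & g = commutator_mx u s].
Proof.
move=> uP Pg du u1 ds uQ dD Qs gsu.
pose c A := invmx P *m A *m P.
have cM A B : c A *m c B = c (A *m B) by rewrite /c !mulmxA mulmxK.
exists (c u), (c s); split.
- by rewrite inE det_conj ?du.
- by rewrite inE det_conj ?ds.
- apply: unipotent_mx_sqr0.
  have -> : c u - 1%:M = c (u - 1%:M).
    by rewrite /c mulmxBr mulmxBl mulmx1 mulVmx.
  by rewrite cM u1 /c mulmx0 mul0mx.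
- apply: (semisimple_mx_similar _ D (Q *m P)) => //.
    by rewrite unitmx_mul uQ.
  by rewrite /c !mulmxA mulmxK // Qs.
- apply: commutator_mx_eq; rewrite ?unitmxE ?det_conj ?du ?ds ?unitr1 //.
  have -> : g = c g' by rewrite /c -mulmxA -Pg mulKmx.
  by rewrite !cM gsu.
Qed.

Theorem proposition5p1 (k : fieldType) (hk : quadratically_closed k)
    (g : 'M[k]_2) (hg : g \in SL k 2) (hgN : g <> - 1%:M) :
  exists u s : 'M[k]_2,
    [/\ u \in SL k 2, s \in SL k 2, unipotent_mx u, semisimple_mx s
      & g = commutator_mx u s].
Proof.
have scalN (a b c d : k) : (b != 0) -> ~~ is_scalar_mx (mx2 a b c d).
  apply: contra => /is_scalar_mxP[x /matrixP/(_ ord0 ord_max)].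
  by rewrite !mxE => /= ->.
have diag2 (a d : k) : is_diag_mx (mx2 a 0 0 d).
  by apply/is_diag_mxP => -[[|[|//]] ?] [[|[|//]] ?]; rewrite !mxE.
have u2 : (mx2 1 1 0 1 - 1%:M) *m (mx2 1 1 0 1 - 1%:M) = 0 :> 'M[k]_2.
  have -> : mx2 1 1 0 1 - 1%:M = mx2 0 1 0 0 :> 'M[k]_2.
    by rewrite [LHS]mx2_eta !mxE /= !subrr !subr0.
  by rewrite mx2E !mul0r !mulr0 !addr0 -scalar_mx2 raddf0.
have du : \det (mx2 1 1 0 1) = 1 :> k by rewrite mx2E; ring.
move: hg; rewrite inE => /eqP det_g.
have [/is_scalar_mxP[a ga]|nsg] := boolP (is_scalar_mx g).
  have : a ^+ 2 == 1 by rewrite -det_g ga det_scalar.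
  rewrite sqrf_eq1 => /orP[]/eqP a1; last first.
    by case: hgN; rewrite ga a1 raddfN.
  apply: (@commutator_of_similar _ _ g 1%:M 1%:M 1%:M 1%:M 1%:M 1%:M);
    by rewrite ?unitmx1 ?mulmx1 ?mul1mx ?subrr ?det1 ?mulmx0
      ?scalar_mx_is_diag ?ga ?a1.
have [l l_neq0 l2_neq1] := quadratically_closed_sqr_neq1 hk.
have [t2|t_neq2] := eqVneq (\tr g) 2.
  (* This target is the commutator of [mx2 1 1 0 1] and [diag(l, l^-1)]; it is not scalar because
     [l ^+ 2 != 1]. *)
  have [P uP Pg] : exists2 P, P \in unitmx & P *m g = mx2 1 (1 - l ^+ 2) 0 1 *m P.
    apply: similar_mx2 => //; rewrite ?mx2E ?det_g ?t2; try ring.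
    by apply: scalN; rewrite subr_eq0 eq_sym.
  apply: (@commutator_of_similar _ _ _ _ (mx2 1 1 0 1) (mx2 l 0 0 l^-1)
    (mx2 l 0 0 l^-1) _ 1%:M uP Pg) => //.
  - by rewrite mx2E; field.
  - exact: unitmx1.
  - by rewrite mul1mx mulmx1.
  - by rewrite !mx2E; congr mx2; field.
have [c c2] := quadratically_closed_root 0 (2 - \tr g) hk.
have c_neq0 : c != 0.
  apply: contra_eq_neq c2 => ->.
  by rewrite expr0n mul0r !add0r subr_eq0 eq_sym.
have trg : \tr g = c ^+ 2 + 2 by rewrite -[LHS]addr0 -c2; ring.
(* This target is the commutator of [mx2 1 1 0 1] with any [s] of determinant 1 and first column
   [(0, c)]. *)
have [P uP Pg] : exists2 P, P \in unitmx &
    P *m g = mx2 (1 + c ^+ 2) 1 (c ^+ 2) 1 *m P.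
  apply: similar_mx2; rewrite ?mx2E ?det_g ?trg ?scalN ?oner_eq0 //; ring.
(* The entry [- c^-1] makes the determinant 1, and the last entry gives [s] the trace of
   [diag(l, l^-1)]. *)
have [Q uQ Qs] : exists2 Q, Q \in unitmx &
    Q *m mx2 0 (- c^-1) c (l + l^-1) = mx2 l 0 0 l^-1 *m Q.
  apply: similar_mx2.
  - by rewrite scalN ?oppr_eq0 ?invr_eq0.
  - apply: contra l2_neq1 => /is_scalar_mxP[x lx].
    have /matrixP/(_ ord0 ord0) := lx; have /matrixP/(_ ord_max ord_max) := lx.
    by rewrite !mxE /= => <- l1; rewrite expr2 {1}l1 mulVf.
  - by rewrite !mx2E; field; rewrite l_neq0.
  - by rewrite !mx2E add0r.
apply: (@commutator_of_similar _ _ _ _ (mx2 1 1 0 1)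
  (mx2 0 (- c^-1) c (l + l^-1)) (mx2 l 0 0 l^-1) _ Q uP Pg) => //.
- by rewrite mx2E; field; rewrite c_neq0.
- by rewrite !mx2E; congr mx2; field; rewrite ?c_neq0 ?l_neq0.
Qed.
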